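(* The following two statements are equivalent (i.e. each one, if true, implies the other). (PC) For every $\epsilon>0$ there is a natural number $r$ such that for every natural number $n$ and every linear operator $T$ on $\ell_2^n$ whose matrix has zero diagonal, there is a partition $\{A_j\}_{j=1}^r$ of $\{1,\dots,n\}$ with $\|Q_{A_j}TQ_{A_j}\|\le \epsilon\|T\|$ for all $j=1,\dots,r$. (PC for triangular matrices) For every $\epsilon>0$ there is a natural number $r$ such that for every natural number $n$ and every linear operator $T$ on $\ell_2^n$ whose matrix is triangular with zero diagonal, there is a partition $\{A_j\}_{j=1}^r$ of $\{1,\dots,n\}$ with $\|Q_{A_j}TQ_{A_j}\|\le \epsilon\|T\|$ for all $j=1,\dots,r$.
   Context: Matrices of operators on $\ell_2^n$ are taken with respect to the standard orthonormal basis $\{e_i\}_{i=1}^n$, i.e. the matrix of $T$ is $(\langle Te_i,e_j\rangle)_{i,j}$. For $A\subset\{1,\dots,n\}$, the diagonal projection $Q_A$ is the matrix whose entries are all zero except the $(i,i)$ entries for $i\in A$, which equal $1$. The number $r$ depends only on $\epsilon$, not on $n$ or $T$. *)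

(* Defs.v *)
From HB Require Import structures.
From mathcomp Require Import all_boot all_order all_algebra.
From mathcomp Require Import all_classical all_reals.
From mathcomp Require Import complex.
Set Implicit Arguments. Unset Strict Implicit. Unset Printing Implicit Defensive.
Import Order.TTheory GRing.Theory Num.Theory.
Local Open Scope ring_scope.


Definition vnorm (R : realType) (n : nat) (x : 'cV[R[i]]_n) : R :=
  Num.sqrt (\sum_(k < n) (complex.Re (x k 0) ^+ 2 + complex.Im (x k 0) ^+ 2)).

Definition opnorm (R : realType) (n : nat) (T : 'M[R[i]]_n) : R :=
  sup [set r : R | exists x : 'cV[R[i]]_n, vnorm x <= 1 /\ r = vnorm (T *m x)]%classic.

Definition diagproj (R : realType) (n : nat) (A : {set 'I_n}) : 'M[R[i]]_n :=
  diag_mx (\row_(k < n) (if k \in A then 1 else 0)).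

Definition zero_diag (R : realType) (n : nat) (T : 'M[R[i]]_n) : Prop :=
  forall k : 'I_n, T k k = 0.

Definition triangular (R : realType) (n : nat) (T : 'M[R[i]]_n) : Prop :=
  is_trig_mx T \/ is_trig_mx T^T.

(* {A_j}_{j<r} is a partition of {0,...,n-1} into r (possibly empty) sets. *)
Definition is_partition (n r : nat) (A : 'I_r -> {set 'I_n}) : Prop :=
  (forall j1 j2 : 'I_r, j1 != j2 -> A j1 :&: A j2 = finset.set0) /\
  (forall k : 'I_n, exists j : 'I_r, k \in A j).

Definition paves (R : realType) (n : nat) (eps : R) (r : nat) (T : 'M[R[i]]_n) : Prop :=
  exists A : 'I_r -> {set 'I_n}, is_partition A /\
    forall j : 'I_r,
      opnorm (diagproj R (A j) *m T *m diagproj R (A j)) <= eps * opnorm T.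

Definition PC (R : realType) : Prop :=
  forall eps : R, 0 < eps -> exists r : nat, forall (n : nat) (T : 'M[R[i]]_n),
    zero_diag T -> paves eps r T.

Definition PC_triangular (R : realType) : Prop :=
  forall eps : R, 0 < eps -> exists r : nat, forall (n : nat) (T : 'M[R[i]]_n),
    triangular T -> zero_diag T -> paves eps r T.

(* Main.v *)
(** To pave a hermitian contraction [T] with zero diagonal, put [G = 1 + t T] for
    a small [t] and let [G = L L^*] be its Cholesky factorization.  The square of
    the pivot [L i i] is at least the minimum of [<x, G x>] over the [x] with
    [x i = 1], and because [T i i = 0] this minimum is [1 - O(t^2)].  So the
    diagonal part [D] of [L] is the identity up to [O(t^2)], while [U = (L - D)^*]
    is triangular with zero diagonal and bounded norm.  Pave [U]: on a block [Q],
    [<x, G x> = |L^* x|^2 >= |Q L^* Q x|^2 = |D x + Q U Q x|^2 >= (1 - o(t)) |x|^2],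
    so that [Q T Q >= - e].  Treating [- T] in the same way and taking the common
    refinement gives [|Q T Q| <= e]; a general [T] is handled through its hermitian
    and skew-hermitian parts. *)
Require Import Defs.
From HB Require Import structures.
From mathcomp Require Import all_boot all_order all_algebra.
From mathcomp Require Import all_classical all_reals.
From mathcomp Require Import complex.
From mathcomp Require Import ring lra.
Set Implicit Arguments. Unset Strict Implicit. Unset Printing Implicit Defensive.
Import Order.TTheory GRing.Theory Num.Theory.
Local Open Scope ring_scope.
Local Open Scope complex_scope.

(** * Adjoints and the real inner product on complex column vectors *)

Definition adjmx (R : realType) (m n : nat) (A : 'M[R[i]]_(m, n)) : 'M[R[i]]_(n, m) :=
  (map_mx conjc A)^T.

(* [Re <x, y>]. *)
Definition rdot (R : realType) (n : nat) (x y : 'cV[R[i]]_n) : R :=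
  \sum_(k < n) (complex.Re (x k 0) * complex.Re (y k 0) +
                complex.Im (x k 0) * complex.Im (y k 0)).

Definition nsq (R : realType) (n : nat) (x : 'cV[R[i]]_n) : R := rdot x x.

Section RealInnerProduct.
Variable R : realType.
Local Notation C := R[i].

Lemma adjmxK m n (A : 'M[C]_(m, n)) : adjmx (adjmx A) = A.
Proof. by apply/matrixP => i j; rewrite !mxE conjcK. Qed.

Lemma adjmxD m n (A B : 'M[C]_(m, n)) : adjmx (A + B) = adjmx A + adjmx B.
Proof. by rewrite /adjmx map_mxD linearD. Qed.

Lemma adjmxN m n (A : 'M[C]_(m, n)) : adjmx (- A) = - adjmx A.
Proof. by rewrite /adjmx map_mxN linearN. Qed.

Lemma adjmxB m n (A B : 'M[C]_(m, n)) : adjmx (A - B) = adjmx A - adjmx B.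
Proof. by rewrite adjmxD adjmxN. Qed.

Lemma adjmxZ m n (a : C) (A : 'M[C]_(m, n)) : adjmx (a *: A) = conjc a *: adjmx A.
Proof. by rewrite /adjmx map_mxZ linearZ. Qed.

Lemma adjmxM m n p (A : 'M[C]_(m, n)) (B : 'M[C]_(n, p)) :
  adjmx (A *m B) = adjmx B *m adjmx A.
Proof. by rewrite /adjmx map_mxM trmx_mul. Qed.

Lemma adjmx1 n : adjmx (1%:M : 'M[C]_n) = 1%:M.
Proof. by rewrite /adjmx map_mx1 trmx1. Qed.

Lemma adjmx0 m n : adjmx (0 : 'M[C]_(m, n)) = 0.
Proof. by rewrite /adjmx map_mx0 trmx0. Qed.

Lemma adjmx_block m1 m2 n1 n2 (A : 'M[C]_(m1, n1)) (B : 'M_(m1, n2))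
    (A' : 'M_(m2, n1)) (B' : 'M_(m2, n2)) :
  adjmx (block_mx A B A' B') =
  block_mx (adjmx A) (adjmx A') (adjmx B) (adjmx B').
Proof. by rewrite /adjmx map_block_mx tr_block_mx. Qed.

Lemma adjmx_scalar n (a : R) : adjmx ((a%:C)%:M : 'M[C]_n) = (a%:C)%:M.
Proof. by rewrite /adjmx map_scalar_mx tr_scalar_mx /= oppr0. Qed.

Lemma rdotE n (x y : 'cV[C]_n) : rdot x y = complex.Re ((adjmx x *m y) 0 0).
Proof.
rewrite mxE (raddf_sum (@complex.Re R : Rcomplex R -> R)) /=.
apply: eq_bigr => k _; rewrite !mxE.
by case: (x k 0) (y k 0) => [a b] [c d] /=; rewrite mulNr opprK.
Qed.

Lemma rdotC n (x y : 'cV[C]_n) : rdot x y = rdot y x.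
Proof. by apply: eq_bigr => k _; rewrite mulrC [X in _ + X]mulrC. Qed.

Lemma rdotDr n (x y z : 'cV[C]_n) : rdot x (y + z) = rdot x y + rdot x z.
Proof.
rewrite -big_split; apply: eq_bigr => k _ /=.
by rewrite mxE; case: (y k 0) (z k 0) => [a b] [c d] /=; ring.
Qed.

Lemma rdotNr n (x y : 'cV[C]_n) : rdot x (- y) = - rdot x y.
Proof.
rewrite -sumrN; apply: eq_bigr => k _ /=.
by rewrite mxE; case: (y k 0) => [a b] /=; ring.
Qed.

Lemma rdotZr n (a : R) (x y : 'cV[C]_n) : rdot x (a%:C *: y) = a * rdot x y.
Proof.
rewrite mulr_sumr; apply: eq_bigr => k _ /=.
by rewrite mxE; case: (y k 0) => [b c] /=; ring.
Qed.

Lemma rdotBr n (x y z : 'cV[C]_n) : rdot x (y - z) = rdot x y - rdot x z.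
Proof. by rewrite rdotDr rdotNr. Qed.

Lemma rdotDl n (x y z : 'cV[C]_n) : rdot (x + y) z = rdot x z + rdot y z.
Proof. by rewrite rdotC rdotDr !(rdotC z). Qed.

Lemma rdotNl n (x y : 'cV[C]_n) : rdot (- x) y = - rdot x y.
Proof. by rewrite rdotC rdotNr rdotC. Qed.

Lemma rdotBl n (x y z : 'cV[C]_n) : rdot (x - y) z = rdot x z - rdot y z.
Proof. by rewrite rdotDl rdotNl. Qed.

Lemma rdotZl n (a : R) (x y : 'cV[C]_n) : rdot (a%:C *: x) y = a * rdot x y.
Proof. by rewrite rdotC rdotZr rdotC. Qed.

Lemma rdot_adj m n (A : 'M[C]_(m, n)) x y :
  rdot (A *m x) y = rdot x (adjmx A *m y).
Proof. by rewrite !rdotE adjmxM mulmxA. Qed.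

Lemma rdot_col_mx m n (x1 y1 : 'cV[C]_m) (x2 y2 : 'cV[C]_n) :
  rdot (col_mx x1 x2) (col_mx y1 y2) = rdot x1 y1 + rdot x2 y2.
Proof.
rewrite /rdot big_split_ord /=; congr (_ + _); apply: eq_bigr => k _.
  by rewrite !col_mxEu.
by rewrite !col_mxEd.
Qed.

Lemma rdot_delta n (i : 'I_n) (x : 'cV[C]_n) :
  rdot (delta_mx i 0) x = complex.Re (x i 0).
Proof.
rewrite /rdot (bigD1 i) //= big1 ?addr0; last first.
  by move=> k ki; rewrite mxE (negbTE ki) /= !mul0r addr0.
by rewrite mxE !eqxx /= mul1r mul0r addr0.
Qed.

Lemma nsq_ge0 n (x : 'cV[C]_n) : 0 <= nsq x.
Proof. by apply: sumr_ge0 => k _; rewrite -!expr2 addr_ge0 ?sqr_ge0. Qed.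

Lemma nsqD n (x y : 'cV[C]_n) : nsq (x + y) = nsq x + nsq y + 2 * rdot x y.
Proof. by rewrite /nsq !rdotDl !rdotDr (rdotC y x); ring. Qed.

Lemma nsqB n (x y : 'cV[C]_n) : nsq (x - y) = nsq x + nsq y - 2 * rdot x y.
Proof. by rewrite /nsq !rdotBl !rdotBr (rdotC y x); ring. Qed.

Lemma nsqN n (x : 'cV[C]_n) : nsq (- x) = nsq x.
Proof. by rewrite /nsq rdotNl rdotNr opprK. Qed.

Lemma nsqZ n (a : C) (x : 'cV[C]_n) :
  nsq (a *: x) = (complex.Re a ^+ 2 + complex.Im a ^+ 2) * nsq x.
Proof.
rewrite mulr_sumr; apply: eq_bigr => k _ /=.
by rewrite mxE; case: a (x k 0) => [b c] [d e] /=; ring.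
Qed.

Lemma nsqD_le n (x y : 'cV[C]_n) : nsq (x + y) <= 2 * nsq x + 2 * nsq y.
Proof. by rewrite nsqD; have := nsq_ge0 (x - y); rewrite nsqB; lra. Qed.

Lemma nsqB_le n (x y : 'cV[C]_n) : nsq (x - y) <= 2 * nsq x + 2 * nsq y.
Proof. by rewrite nsqB; have := nsq_ge0 (x + y); rewrite nsqD; lra. Qed.

(** Expand [|a x + y|^2 >= 0] and divide by [a]. *)
Lemma young n (a : R) (x y : 'cV[C]_n) : 0 < a ->
  - 2 * rdot x y <= a * nsq x + a^-1 * nsq y.
Proof.
move=> a0; have := nsq_ge0 (a%:C *: x + y).
rewrite nsqD nsqZ /= rdotZl expr0n addr0 => h.
have := mulr_ge0 (ltW (_ : 0 < a^-1)) h; rewrite invr_gt0 => /(_ a0).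
suff -> : a^-1 * (a ^+ 2 * nsq x + nsq y + 2 * (a * rdot x y)) =
  a * nsq x + a^-1 * nsq y + 2 * rdot x y by lra.
by field; rewrite gt_eqF.
Qed.

Lemma nsq_delta n (i : 'I_n) : nsq (delta_mx i 0 : 'cV[C]_n) = 1.
Proof. by rewrite /nsq rdot_delta mxE !eqxx. Qed.

End RealInnerProduct.

(** * Cholesky factorization with pivots bounded below *)

Section Cholesky.
Variable R : realType.
Local Notation C := R[i].

(* The hypothesis on [rdot x (G *m x)] is inherited by Schur complements, so that
   the recursion bounds every pivot. *)
Lemma cholesky (d : R) : 0 < d -> forall n (G : 'M[C]_n), adjmx G = G ->
  (forall i (x : 'cV[C]_n), x i 0 = 1 -> d <= rdot x (G *m x)) ->
  exists L : 'M[C]_n, [/\ is_trig_mx L, L *m adjmx L = G &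
    forall i, exists2 a : R, L i i = a%:C & d <= a ^+ 2].
Proof.
move=> d0; elim=> [|n IHn] G.
  by move=> _ _; exists 0; split=> [| | []//];
    [apply/is_trig_mxP => [[]] | apply/matrixP => [[]]].
move: G; rewrite -[n.+1]/(1 + n)%N => G; rewrite -(submxK G).
move: (ulsubmx G) (ursubmx G) (dlsubmx G) (drsubmx G) => a0 b' b S {G}.
rewrite adjmx_block => /eq_block_mx [a0_adj <- {b'} _ S_adj] Gd.
have [a a0E] : exists a : R, a0 = (a%:C)%:M.
  exists (complex.Re (a0 0 0)); rewrite [LHS]mx11_scalar; congr (_%:M).
  move/matrixP/(_ 0 0): a0_adj; rewrite !mxE.
  by case: (a0 0 0) => u v /= [vv]; congr (_ +i* _); lra.
(* Testing [Gd] on the first basis vector reads off the corner entry [a]. *)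
have da : d <= a.
  have := Gd (lshift n 0) (col_mx 1%:M 0); rewrite col_mxEu mxE => /(_ erefl).
  rewrite mul_block_col !mulmx0 !addr0 !mulmx1 rdot_col_mx a0E.
  have -> : rdot (0 : 'cV_n) b = 0 by rewrite -(subrr 0) rdotBl subrr.
  by rewrite addr0 rdotE adjmx1 mul1mx mxE.
have a_gt0 : 0 < a by apply: lt_le_trans da.
have a_n0 : a%:C != 0 :> C by rewrite eq_complex /= negb_and gt_eqF.
(* Recursion on the Schur complement of the corner [a]. *)
have [| |L' [L'trig L'E L'd]] := IHn (S - (a%:C)^-1 *: (b *m adjmx b)).
- rewrite adjmxB adjmxZ adjmxM adjmxK S_adj.
  by rewrite conjc_inv conjc_real.
- move=> i y yi.
  (* This choice of top entry makes the first coordinate of [G x] vanish, so [<x, G x>] equals the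
     form of the Schur complement at [y]. *)
  have := Gd (rshift 1 i) (col_mx (- (a%:C)^-1 *: (adjmx b *m y)) y).
  rewrite col_mxEd => /(_ yi) /le_trans; apply.
  rewrite mul_block_col a0E mul_scalar_mx scalerA mulrN mulfV // scaleN1r addNr.
  rewrite rdot_col_mx rdotE mulmx0 mxE add0r.
  rewrite mulmxBl -scalemxAl -mulmxA scaleNr mulmxN -scalemxAr.
  by rewrite [- _ + _]addrC.
pose r := Num.sqrt a.
have r2 : r ^+ 2 = a by rewrite sqr_sqrtr // ltW.
have r_n0 : r%:C != 0 :> C by rewrite eq_complex /= negb_and gt_eqF // sqrtr_gt0.
exists (block_mx (r%:C)%:M 0 ((r%:C)^-1 *: b) L'); split.
- by rewrite is_trig_block_mx // eqxx /= L'trig andbT scalar_mx_is_trig.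
- rewrite adjmx_block mulmx_block adjmx_scalar adjmx0 adjmxZ conjc_inv conjc_real.
  rewrite !mul0mx !mulmx0 !addr0 L'E -scalar_mxM -rmorphM -expr2 r2 -a0E.
  rewrite mul_scalar_mx mul_mx_scalar !scalerA mulfV // !scale1r.
  rewrite -scalemxAl -scalemxAr scalerA -invfM -rmorphM -expr2 r2.
  by rewrite addrC subrK.
- move=> i; case: (splitP i) => j ij.
    exists r; last by rewrite r2.
    have -> : i = lshift n j by apply/val_inj.
    by rewrite block_mxEul ord1 mxE eqxx mulr1n.
  have [c cE dc] := L'd j; exists c => //.
  have -> : i = rshift 1 j by apply/val_inj.
  by rewrite block_mxEdr.
Qed.
End Cholesky.

(** * The operator norm as a supremum *)

Section OperatorNorm.
Variable R : realType.
Local Notation C := R[i].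

Lemma vnorm_sqr n (x : 'cV[C]_n) : vnorm x ^+ 2 = nsq x.
Proof. by rewrite /vnorm sqr_sqrtr // (nsq_ge0 x). Qed.

Lemma vnorm_ge0 n (x : 'cV[C]_n) : 0 <= vnorm x.
Proof. exact: sqrtr_ge0. Qed.

Lemma nsq_normE n (x : 'cV[C]_n) : (nsq x)%:C = \sum_k `|x k 0| ^+ 2.
Proof.
rewrite rmorph_sum; apply: eq_bigr => k _.
by rewrite -add_Re2_Im2 -!expr2.
Qed.

Lemma nsq_eq0 n (x : 'cV[C]_n) : nsq x = 0 -> x = 0.
Proof.
move=> x0; apply/matrixP => k j; rewrite ord1 mxE.
have /eqP := nsq_normE x; rewrite x0 eq_sym psumr_eq0 => [/allP/(_ k)|i _].
  by rewrite mem_index_enum => /(_ isT); rewrite sqrf_eq0 normr_eq0 => /eqP.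
by rewrite exprn_ge0.
Qed.

Lemma nsq0 n : nsq (0 : 'cV[C]_n) = 0.
Proof. by rewrite -[X in nsq X](scale0r 0) nsqZ /= expr0n addr0 mul0r. Qed.

Lemma vnormZ n (a : R) (x : 'cV[C]_n) : 0 <= a -> vnorm (a%:C *: x) = a * vnorm x.
Proof.
move=> a0; apply: (@pexpIrn _ 2) => //; rewrite ?nnegrE ?mulr_ge0 ?vnorm_ge0 //.
by rewrite exprMn !vnorm_sqr nsqZ /= expr0n addr0.
Qed.

Lemma entry_sqr_le_nsq n (x : 'cV[C]_n) i : complex.Re (x i 0) ^+ 2 <= nsq x.
Proof.
rewrite /nsq /rdot (bigD1 i) //= -!expr2.
rewrite -addrA lerDl addr_ge0 ?sqr_ge0 // sumr_ge0 // => k _.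
by rewrite -!expr2 addr_ge0 ?sqr_ge0.
Qed.

(** Without a bound, [sup] would only return a default value. If [|x| <= 1], every coordinate of [x]
    has modulus at most 1, so each coordinate of [T x] is at most the sum of the moduli in that row
    of [T]. *)
Lemma opnorm_set_ubound n (T : 'M[C]_n) :
  has_ubound [set r : R | exists x : 'cV[C]_n, vnorm x <= 1 /\ r = vnorm (T *m x)]%classic.
Proof.
pose c : C := \sum_i (\sum_j `|T i j|) ^+ 2.
exists (Num.sqrt (complex.Re c)) => _ [x [x1 ->]].
apply: ler_wsqrtr; rewrite -[leLHS]/(nsq (T *m x)).
suff : (nsq (T *m x))%:C <= c by rewrite lecE => /andP[].
rewrite nsq_normE; apply: ler_sum => i _.
rewrite ler_sqr ?nnegrE ?sumr_ge0 // mxE.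
apply: le_trans (ler_norm_sum _ _ _) _; apply: ler_sum => j _.
rewrite normrM ler_piMr // -(@ler_sqr C) ?nnegrE // expr1n.
have x1C : (nsq x)%:C <= 1 by rewrite -[1]/(1%:C) lecR -vnorm_sqr expr_le1 ?vnorm_ge0.
apply: le_trans x1C; rewrite nsq_normE (bigD1 j) //= lerDl sumr_ge0 // => k _.
by rewrite exprn_ge0.
Qed.

Lemma opnorm_ge0 n (T : 'M[C]_n) : 0 <= opnorm T.
Proof.
apply: ub_le_sup; first exact: opnorm_set_ubound.
by exists 0; rewrite mulmx0 -[vnorm 0]ger0_norm ?vnorm_ge0 // -sqrtr_sqr
  vnorm_sqr nsq0 sqrtr0 ler01.
Qed.

Lemma nsq_mulmx_opnorm n (T : 'M[C]_n) x :
  nsq (T *m x) <= opnorm T ^+ 2 * nsq x.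
Proof.
have [x0|x_n0] := eqVneq (nsq x) 0.
  by rewrite (nsq_eq0 x0) mulmx0 nsq0 mulr0.
have nx : 0 < vnorm x by rewrite lt_neqAle vnorm_ge0 andbT eq_sym -sqrf_eq0 vnorm_sqr.
rewrite -!vnorm_sqr -exprMn ler_sqr ?nnegrE ?mulr_ge0 ?vnorm_ge0 ?opnorm_ge0 //.
rewrite -ler_pdivrMr // mulrC.
apply: ub_le_sup; first exact: opnorm_set_ubound.
exists ((vnorm x)^-1%:C *: x); split.
  by rewrite vnormZ ?invr_ge0 ?vnorm_ge0 // mulVf // gt_eqF.
by rewrite -scalemxAr vnormZ // invr_ge0 vnorm_ge0.
Qed.

Lemma opnorm_le n (T : 'M[C]_n) c : 0 <= c ->
  (forall x, nsq (T *m x) <= c ^+ 2 * nsq x) -> opnorm T <= c.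
Proof.
move=> c0 Tc; apply: ge_sup.
  by exists (vnorm (T *m 0)), 0; rewrite -[vnorm 0]ger0_norm ?vnorm_ge0 // -sqrtr_sqr
    vnorm_sqr nsq0 sqrtr0 ler01.
move=> _ [x [x1 ->]]; rewrite -(@ler_sqr R) ?nnegrE ?vnorm_ge0 // vnorm_sqr.
apply: le_trans (Tc x) _; rewrite ler_piMr ?sqr_ge0 // -vnorm_sqr.
by rewrite expr_le1 ?vnorm_ge0.
Qed.

(** * Contractions and hermitian operators *)

Definition contraction n (T : 'M[C]_n) := forall x, nsq (T *m x) <= nsq x.

(** Both signs come from [|x + T x|^2 >= 0] and [|x - T x|^2 >= 0]. *)
Lemma contraction_rdot n (T : 'M[C]_n) x : contraction T -> `|rdot x (T *m x)| <= nsq x.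
Proof.
move=> /(_ x) Tx; have := nsq_ge0 (x + T *m x); have := nsq_ge0 (x - T *m x).
by rewrite nsqB nsqD ler_norml => h1 h2; apply/andP; split; lra.
Qed.

(** With [S] the adjoint of [T], expand [|x - T S x|^2 >= 0]: the cross term is [-2 |S x|^2], and
    [|T S x|^2 <= |S x|^2]. *)
Lemma contraction_adj n (T : 'M[C]_n) : contraction T -> contraction (adjmx T).
Proof.
move=> Tc x; have := nsq_ge0 (x - T *m (adjmx T *m x)); have := Tc (adjmx T *m x).
rewrite nsqB (rdotC x) rdot_adj -/(nsq _); lra.
Qed.

(** Polarization: for [u = e x] and [y = S x], the forms of [S] at [u + y] and [u - y] differ by
    [4 e |y|^2], while the hypothesis and the parallelogram law bound this by
    [2 e (|u|^2 + |y|^2)]. *)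
Lemma herm_nsq_le n (S : 'M[C]_n) e : 0 < e -> adjmx S = S ->
  (forall x, `|rdot x (S *m x)| <= e * nsq x) ->
  forall x, nsq (S *m x) <= e ^+ 2 * nsq x.
Proof.
move=> e0 Sadj Se x; set y := S *m x; set u := e%:C *: x.
have := Se (u - y); have := Se (u + y); rewrite !ler_norml.
have Su : S *m u = e%:C *: y by rewrite -scalemxAr.
have uS : rdot u (S *m y) = e * nsq y by rewrite -{1}Sadj -rdot_adj Su rdotZl.
rewrite mulmxDr mulmxBr !rdotDl !rdotNl !rdotDr !rdotNr uS Su !rdotZr -/(nsq y).
rewrite nsqB nsqD nsqZ /= expr0n addr0 => /andP[_ h1] /andP[h2 _].
rewrite -(ler_pM2l e0); lra.
Qed.

(** * Diagonal projections *)

Lemma diagproj_entry n (A : {set 'I_n}) (x : 'cV[C]_n) k :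
  (diagproj R A *m x) k 0 = if k \in A then x k 0 else 0.
Proof. by rewrite mul_diag_mx !mxE; case: ifP; rewrite ?mul1r ?mul0r. Qed.

Lemma diagproj_sub n (A B : {set 'I_n}) : A \subset B ->
  diagproj R B *m diagproj R A = diagproj R A.
Proof.
move=> AB; apply/matrixP => i j; rewrite mul_diag_mx !mxE.
case: eqP => [->|_]; last by rewrite !mulr0n mulr0.
have [jA|_] := boolP (j \in A); last by rewrite mul0rn mulr0.
by rewrite (fintype.subsetP AB _ jA) mul1r.
Qed.

Lemma diagproj_adj n (A : {set 'I_n}) : adjmx (diagproj R A) = diagproj R A.
Proof.
apply/matrixP => i j; rewrite !mxE eq_sym; case: eqP => [->|_].
  by case: ifP => _; rewrite !mulr1n ?conjc1 ?conjc0.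
by rewrite !mulr0n conjc0.
Qed.

Lemma diagproj_nsq n (A : {set 'I_n}) (x : 'cV[C]_n) : nsq (diagproj R A *m x) <= nsq x.
Proof.
apply: ler_sum => k _; rewrite diagproj_entry; case: ifP => _ //=.
by rewrite !mul0r addr0 -!expr2 addr_ge0 ?sqr_ge0.
Qed.

End OperatorNorm.

(** * From paving triangular operators to paving all operators *)

Section Paving.
Variable R : realType.
Local Notation C := R[i].

(** The partition is given as a coloring [f], and the bound is claimed for every subset [A] of a
    color class, so that it survives passing to a common refinement. *)
Lemma triangular_paves_below : PC_triangular R -> forall e : R, 0 < e ->
  exists r : nat, forall n (T : 'M[C]_n),
    adjmx T = T -> zero_diag T -> contraction T ->
    exists f : 'I_n -> 'I_r, forall c (A : {set 'I_n}),
      {in A, forall k, f k = c} ->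
      forall x, diagproj R A *m x = x -> - e * nsq x <= rdot x (T *m x).
Proof.
move=> PCt e e0.
(* The final loss is [2 t^2 + 2 h]: [t <= e / 4] and [h = t e / 4] make each term at most [t e / 2].
   The bound [t <= 1 / 2] keeps [d] positive. *)
pose t := Num.min (e / 4) (1 / 2).
have t0 : 0 < t by rewrite lt_min !divr_gt0.
have [te t2] : t <= e / 4 /\ t <= 1 / 2 by rewrite /t !ge_min !lexx orbT.
pose h := t * e / 4.
have h0 : 0 < h by rewrite !mulr_gt0 // invr_gt0.
(* The divisor 3 cancels the bound [U3] on the norm of [U]. *)
have [r rP] := PCt (h / 3) (divr_gt0 h0 (ltr0n _ 3)).
exists r => n T Tadj T0 Tc.
pose G := 1%:M + t%:C *: T.
have GE x : G *m x = x + t%:C *: (T *m x) by rewrite mulmxDl mul1mx -scalemxAl.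
have Gadj : adjmx G = G by rewrite adjmxD adjmx1 adjmxZ conjc_real Tadj.
pose d := 1 - 2 * t ^+ 2.
have d0 : 0 < d by rewrite /d; nra.
have [|L [Ltrig LG Ldiag]] := cholesky d0 Gadj.
  (* Split [x = v + z] with [v] the basis vector and [z] orthogonal to it. The term [<v, T v>]
     vanishes, and the cross term [2 t <T v, z>] costs at most [2 t^2 + |z|^2 / 2]; the other half
     of [|z|^2] absorbs [t <z, T z>]. *)
  move=> i x xi; pose v : 'cV[C]_n := delta_mx i 0; pose z := x - v.
  have xE : x = v + z by rewrite /z addrCA subrr addr0.
  have vz : rdot v z = 0 by rewrite rdot_delta !mxE xi !eqxx subrr.
  clearbody z.
  have vTv : rdot v (T *m v) = 0 by rewrite rdot_delta -colE mxE T0.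
  have vTz : rdot v (T *m z) = rdot (T *m v) z by rewrite rdot_adj Tadj.
  have zTv : rdot z (T *m v) = rdot (T *m v) z by rewrite rdotC.
  have xTx : rdot x (T *m x) = 2 * rdot (T *m v) z + rdot z (T *m z).
    by rewrite xE mulmxDr !rdotDl !rdotDr vTv vTz zTv; ring.
  rewrite GE rdotDr rdotZr xTx -/(nsq x) xE nsqD vz nsq_delta.
  have := contraction_rdot z Tc; rewrite ler_norml => /andP[zTz _].
  have Tv : nsq (T *m v) <= 1 by apply: le_trans (Tc _) _; rewrite nsq_delta.
  have := young (t%:C *: (T *m v)) z (ltr0n _ 2); rewrite nsqZ rdotZl /= expr0n addr0.
  have z0 := nsq_ge0 z; have tTv : t ^+ 2 * nsq (T *m v) <= t ^+ 2 by rewrite ler_piMr ?sqr_ge0.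
  have tz : t * - nsq z <= t * rdot z (T *m z) by rewrite ler_pM2l.
  have tz2 : t * nsq z <= 1 / 2 * nsq z by rewrite ler_wpM2r.
  rewrite /d; lra.
have Lnsq x : nsq (adjmx L *m x) = nsq x + t * rdot x (T *m x).
  by rewrite /nsq rdot_adj adjmxK mulmxA LG GE rdotDr rdotZr.
pose l i : R := complex.Re (L i i).
have lE i : L i i = (l i)%:C by rewrite /l; have [a ->] := Ldiag i.
have ld i : d <= l i ^+ 2 by rewrite /l; have [a ->] := Ldiag i.
(* [l i] is one coordinate of the image of the [i]-th basis vector under [adjmx L], and that image
   has squared length [G i i = 1]. *)
have l1 i : l i ^+ 2 <= 1.
  have := entry_sqr_le_nsq (adjmx L *m delta_mx i 0) i.
  rewrite Lnsq nsq_delta rdot_delta -!colE !mxE T0 lE /=.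
  by rewrite mulr0 addr0.
pose D : 'M[C]_n := diag_mx (\row_k (l k)%:C).
have DE x k : (D *m x) k 0 = (l k)%:C * x k 0 by rewrite mul_diag_mx !mxE.
have Dnsq x : nsq (D *m x) = \sum_k l k ^+ 2 *
    (complex.Re (x k 0) * complex.Re (x k 0) + complex.Im (x k 0) * complex.Im (x k 0)).
  apply: eq_bigr => k _; rewrite DE; case: (x k 0) => a b /=; ring.
have Dge x : d * nsq x <= nsq (D *m x).
  rewrite Dnsq mulr_sumr; apply: ler_sum => k _; apply: ler_wpM2r => //.
  by rewrite -!expr2 addr_ge0 ?sqr_ge0.
have Dle x : nsq (D *m x) <= nsq x.
  rewrite Dnsq; apply: ler_sum => k _; apply: ler_piMl => //.
  by rewrite -!expr2 addr_ge0 ?sqr_ge0.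
have tT x : t * rdot x (T *m x) <= 1 / 2 * nsq x.
  have := contraction_rdot x Tc; rewrite ler_norml => /andP[_ xTx].
  have : t * rdot x (T *m x) <= t * nsq x by rewrite ler_pM2l.
  by move/le_trans; apply; rewrite ler_wpM2r // nsq_ge0.
pose U := adjmx L - D.
have U0 : zero_diag U by move=> k; rewrite !mxE eqxx lE conjc_real subrr.
have Utri : triangular U.
  right; apply/is_trig_mxP => i j ij; rewrite !mxE.
  rewrite (is_trig_mxP Ltrig) // conjc0 sub0r; case: eqP => [ji|_]; last by rewrite mulr0n oppr0.
  by rewrite ji ltnn in ij.
(* [|U x|^2 <= 2 (3/2) |x|^2 + 2 |x|^2 = 5 |x|^2], and 5 is below 9. *)
have U3 : opnorm U <= 3.
  apply: opnorm_le => // x; rewrite mulmxBl.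
  apply: le_trans (nsqB_le _ _) _; rewrite Lnsq.
  have := Dle x; have := tT x; have := nsq_ge0 x; lra.
have [A [[_ Acover] Apave]] := rP n U Utri U0.
have [f fA] := fin_all_exists Acover.
exists f => c B fB x Bx.
have BA : B \subset A c by apply/fintype.subsetP => k /fB <-.
have Ax : diagproj R (A c) *m x = x by rewrite -{1}Bx mulmxA diagproj_sub.
pose w := diagproj R (A c) *m U *m diagproj R (A c) *m x.
have wh : nsq w <= h ^+ 2 * nsq x.
  rewrite /w; apply: le_trans (nsq_mulmx_opnorm _ _) _; apply: ler_wpM2r; first exact: nsq_ge0.
  rewrite ler_sqr ?nnegrE ?opnorm_ge0 ?(ltW h0) //; apply: le_trans (Apave c) _.
  have : h / 3 * opnorm U <= h / 3 * 3 by rewrite ler_pM2l // divr_gt0.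
  lra.
(* [D] is diagonal, so [D x] stays supported in [A c] and the projection fixes it. *)
have QL : diagproj R (A c) *m (adjmx L *m x) = D *m x + w.
  rewrite /w -!mulmxA Ax mulmxBl mulmxBr addrCA -[LHS]addr0; congr (_ + _).
  apply/esym/eqP; rewrite subr_eq0; apply/eqP/matrixP => k j; rewrite ord1.
  rewrite diagproj_entry DE; case: ifP => // kA.
  by rewrite -{1}Ax diagproj_entry kA mulr0.
(* Projecting shortens, so [|D x + w|^2 <= |x|^2 + t <x, T x>]; [young] bounds the cross term by
   [2 h |x|^2]. *)
have := diagproj_nsq (A c) (adjmx L *m x); rewrite QL Lnsq nsqD.
have := young (D *m x) w h0.
have hw : h^-1 * nsq w <= h * nsq x.
  by rewrite -(ler_pM2l h0) mulrA mulfV ?gt_eqF // mul1r mulrA -expr2.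
have hD : h * nsq (D *m x) <= h * nsq x by rewrite ler_pM2l.
have := Dge x; have := nsq_ge0 w; have x0 := nsq_ge0 x.
have t2x : 2 * t ^+ 2 * nsq x <= t * e / 2 * nsq x by rewrite ler_wpM2r //; nra.
have hx : h * nsq x = t * e / 4 * nsq x by [].
rewrite /d => *; rewrite -(ler_pM2l t0); lra.
Qed.

(** Coloring by pairs refines the colorings obtained for [T] and for [- T]; the two one-sided bounds
    then control the form of the compression, hence its norm. *)
Lemma triangular_paves_herm : PC_triangular R -> forall e : R, 0 < e ->
  exists F : finType, forall n (T : 'M[C]_n),
    adjmx T = T -> zero_diag T -> contraction T ->
    exists f : 'I_n -> F, forall c (A : {set 'I_n}),
      {in A, forall k, f k = c} ->
      forall x, nsq (diagproj R A *m T *m diagproj R A *m x) <= e ^+ 2 * nsq x.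
Proof.
move=> PCt e e0; have [r rP] := triangular_paves_below PCt e0.
exists ('I_r * 'I_r)%type => n T Tadj T0 Tc.
have [f1 f1P] := rP n T Tadj T0 Tc.
have [|||f2 f2P] := rP n (- T).
- by rewrite adjmxN Tadj.
- by move=> k; rewrite mxE T0 oppr0.
- by move=> x; rewrite mulNmx nsqN.
exists (fun k => (f1 k, f2 k)) => -[c1 c2] A fA.
have fA1 : {in A, forall k, f1 k = c1} by move=> k /fA[].
have fA2 : {in A, forall k, f2 k = c2} by move=> k /fA[].
apply: herm_nsq_le => // [|x].
  by rewrite !adjmxM diagproj_adj Tadj mulmxA.
pose y := diagproj R A *m x.
have Ay : diagproj R A *m y = y by rewrite mulmxA diagproj_sub.
have -> : rdot x (diagproj R A *m T *m diagproj R A *m x) = rdot y (T *m y).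
  by rewrite /y rdot_adj diagproj_adj !mulmxA.
apply: (@le_trans _ _ (e * nsq y)); last by rewrite ler_pM2l // diagproj_nsq.
have := f2P _ _ fA2 _ Ay; have := f1P _ _ fA1 _ Ay.
rewrite mulNmx rdotNr ler_norml => h1 h2; apply/andP; split; lra.
Qed.

(** [H] and [K] are the usual real and imaginary parts of [T]; each is half a sum or difference of
    two contractions, up to a unit scalar. *)
Lemma herm_parts n (T : 'M[C]_n) : zero_diag T -> contraction T ->
  exists H K : 'M[C]_n, [/\ T = H + 'i *: K,
    [/\ adjmx H = H, zero_diag H & contraction H] &
    [/\ adjmx K = K, zero_diag K & contraction K]].
Proof.
move=> T0 Tc; have Tac := contraction_adj Tc.
pose a : C := (2^-1)%:C; pose b : C := - 'i * (2^-1)%:C.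
have i2 : 'i * 'i = -1 :> C by rewrite -expr2 sqr_i.
have aa : a + a = 1 by rewrite -rmorphD (_ : 2^-1 + 2^-1 = 1 :> R) //; lra.
exists (a *: (T + adjmx T)), (b *: (T - adjmx T)); split.
- rewrite scalerA /b mulrA mulrN i2 opprK mul1r -scalerDr addrACA subrr addr0.
  by rewrite scalerDr -scalerDl aa scale1r.
- split.
  + by rewrite adjmxZ adjmxD adjmxK conjc_real addrC.
  + by move=> k; rewrite !mxE T0 conjc0 addr0 mulr0.
  + move=> x; rewrite -scalemxAl mulmxDl nsqZ /= expr0n addr0.
    have := nsqD_le (T *m x) (adjmx T *m x); have := Tc x; have := Tac x; lra.
- split.
  + rewrite adjmxZ adjmxB adjmxK -[adjmx T - T]opprB scalerN -scaleNr; congr (_ *: _).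
    by apply/eqP; rewrite eq_complex /=; apply/andP; split; apply/eqP; ring.
  + by move=> k; rewrite !mxE T0 conjc0 subr0 mulr0.
  + move=> x; rewrite -scalemxAl mulmxBl nsqZ /=.
    have := nsqB_le (T *m x) (adjmx T *m x); have := Tc x; have := Tac x; lra.
Qed.

Lemma triangular_paves : PC_triangular R -> PC R.
Proof.
move=> PCt e e0.
(* Precision [e / 2] for each part suffices: [|a + b|^2 <= 2 |a|^2 + 2 |b|^2] gives
   [4 (e / 2)^2 = e^2]. *)
have [F FP] := triangular_paves_herm PCt (divr_gt0 e0 (ltr0n _ 2)).
exists #|{: F * F}| => n T T0.
pose M := opnorm T; have M0 : 0 <= M := opnorm_ge0 T.
pose T1 := (M^-1)%:C *: T.
have TT1 : T = M%:C *: T1.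
  (* When [M = 0] the inverse is 0 by convention, so the identity requires [T = 0], checked on basis
     vectors. *)
  have [MZ|Mn0] := eqVneq M 0; last first.
    by rewrite scalerA -rmorphM mulfV // scale1r.
  rewrite MZ scale0r; apply/matrixP => i j; rewrite -[T i j]mulr1.
  have /nsq_eq0 /matrixP/(_ i 0) : nsq (T *m delta_mx j 0) = 0.
    apply/eqP; rewrite eq_le nsq_ge0 andbT.
    by have := nsq_mulmx_opnorm T (delta_mx j 0); rewrite -/M MZ expr0n mul0r.
  by rewrite -colE !mxE mulr1.
have T1c : contraction T1.
  move=> x; rewrite -scalemxAl nsqZ /= expr0n addr0.
  have [MZ|Mn0] := eqVneq M 0; first by rewrite MZ invr0 expr0n mul0r nsq_ge0.
  rewrite exprVn -(@ler_pM2l _ (M ^+ 2)) ?exprn_gt0 ?lt_neqAle 1?eq_sym ?Mn0 //.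
  by rewrite mulrA mulfV ?expf_neq0 // mul1r nsq_mulmx_opnorm.
have T10 : zero_diag T1 by move=> k; rewrite mxE T0 mulr0.
have [H [K [T1E [Hadj H0 Hc] [Kadj K0 Kc]]]] := herm_parts T10 T1c.
have [f fP] := FP n H Hadj H0 Hc; have [g gP] := FP n K Kadj K0 Kc.
(* The cells are the joint color classes of [f] and [g]; their number depends only on [F], hence
   only on [e]. *)
pose A (j : 'I_#|{: F * F}|) := [set k | enum_rank (f k, g k) == j].
exists A; split; first split.
- move=> j1 j2 j12; apply/setP => k; rewrite !inE.
  by case: eqP => [->|//]; rewrite (negbTE j12).
- by move=> k; exists (enum_rank (f k, g k)); rewrite inE.
move=> j; apply: opnorm_le => [|x]; first by rewrite mulr_ge0 // ltW.
have fA : {in A j, forall k, f k = (enum_val j).1}.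
  by move=> k; rewrite inE => /eqP <-; rewrite enum_rankK.
have gA : {in A j, forall k, g k = (enum_val j).2}.
  by move=> k; rewrite inE => /eqP <-; rewrite enum_rankK.
rewrite -/M {1}TT1 T1E -scalemxAr -!scalemxAl nsqZ /= expr0n addr0 exprMn [e ^+ 2 * _]mulrC.
rewrite -(mulrA (M ^+ 2) (e ^+ 2)); apply: ler_wpM2l; first exact: sqr_ge0.
rewrite mulmxDr !mulmxDl -scalemxAr -!scalemxAl.
apply: le_trans (nsqD_le _ _) _; rewrite (nsqZ 'i) /= expr0n expr1n add0r mul1r.
by have := fP _ _ fA x; have := gP _ _ gA x; lra.
Qed.

End Paving.

Theorem theorem3p1 (R : realType) : PC R <-> PC_triangular R.
Proof.
split=> [PCR e e0|]; last exact: triangular_paves.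
by have [r rP] := PCR e e0; exists r => n T _; apply: rP.
Qed.
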